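(* Let $K$ be a compact Hausdorff space, and let $\varphi\in(\mathrm{C}(K)^\delta)^\ast_+$ be a positive functional, identified with a positive measure in $\mathrm{M}(\Sigma^{\mathcal{C}}_K,\mathcal{N}_K)$. Then $\varphi$ is strictly positive if and only if, for every $A\in\Sigma^{\mathcal{C}}_K$, $\varphi(A)=0$ if and only if $A\in\mathcal{N}_K$.
   Context: $\mathrm{C}(K)^\delta$ is the Dedekind completion of the Banach lattice $\mathrm{C}(K)$ of continuous real-valued functions on $K$: the unique (up to linear lattice isometry) Dedekind complete Banach lattice containing $\mathrm{C}(K)$ as a majorizing, order dense (isometrically embedded) sublattice. $\mathcal{N}_K$ is the collection of meagre subsets of $K$, and $\Sigma^{\mathcal{C}}_K=\{U\Delta N: U\subseteq K\text{ open},\ N\in\mathcal{N}_K\}$ is the $\sigma$-algebra of sets with the property of Baire. $\mathrm{L}^\infty(\Sigma^{\mathcal{C}}_K,\mathcal{N}_K)$ is the vector lattice of bounded real-valued $\Sigma^{\mathcal{C}}_K$-measurable functions on $K$ modulo the ideal of those vanishing off a meagre set; the class of $u$ is $\hat u$, so $\hat f\le\hat g$ iff $\{x: f(x)>g(x)\}\in\mathcal{N}_K$, and the norm is $\|\hat f\|_\infty=\inf\{c\ge0:\{x:|f(x)|>c\}\in\mathcal{N}_K\}$. $\mathrm{C}(K)^\delta$ is identified with $\mathrm{L}^\infty(\Sigma^{\mathcal{C}}_K,\mathcal{N}_K)$ via $\mathrm{C}(K)\ni u\mapsto\hat u$. $\mathrm{M}(\Sigma^{\mathcal{C}}_K,\mathcal{N}_K)$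 is the Banach lattice of bounded finitely additive signed measures $\mu$ on $\Sigma^{\mathcal{C}}_K$ with $\mu(N)=0$ for all $N\in\mathcal{N}_K$ (setwise order, total variation norm). The dual $(\mathrm{C}(K)^\delta)^\ast$ is identified with $\mathrm{M}(\Sigma^{\mathcal{C}}_K,\mathcal{N}_K)$ via the isometric lattice isomorphism determined by $\varphi(\hat u)=\int_K u\,d\varphi$, so that $\varphi(A)=\varphi(\hat{\mathbf 1}_A)$ for $A\in\Sigma^{\mathcal{C}}_K$; the same symbol is used for the functional and the measure. A functional $\varphi$ on a vector lattice $E$ is strictly positive if $\varphi(f)>0$ for every $f\in E$ with $f>0$ (i.e. $f\ge0$, $f\ne0$). *)

(* Defs.v *)
From HB Require Import structures.
From mathcomp Require Import all_boot all_order all_algebra.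
From mathcomp Require Import generic_quotient ring_quotient.
From mathcomp Require Import all_classical all_reals all_analysis.
From mathcomp Require Import measurable_realfun.
Import Order.TTheory GRing.Theory Num.Theory.
Import numFieldNormedType.Exports.

Set Implicit Arguments.
Unset Strict Implicit.
Unset Printing Implicit Defensive.

Local Open Scope classical_set_scope.
Local Open Scope ring_scope.
Local Open Scope quotient_scope.

Section Category.
Variable K : topologicalType.
Implicit Types A B U : set K.

Definition nowhere_dense A := (closure A)° = set0.

Definition meagre A := exists2 F : (set K)^nat,
  (forall n, nowhere_dense (F n)) & A = \bigcup_n F n.

Definition baire_property A := exists U N,
  [/\ open U, meagre N & A = U `+` N].

Lemma nowhere_dense_sub A B : A `<=` B -> nowhere_dense B -> nowhere_dense A.
Proof.
move=> AB ndB; apply/seteqP; split=> // x.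
by rewrite -[X in _ -> X]/(set0 x) -ndB; apply: interiorS; exact: closureS.
Qed.

Lemma nowhere_dense0 : nowhere_dense set0.
Proof. by rewrite /nowhere_dense closure0 interior0. Qed.

Lemma nowhere_dense_meagre A : nowhere_dense A -> meagre A.
Proof.
move=> ndA; exists (fun=> A) => //.
by apply/seteqP; split=> [x Ax|x [n _] //]; exists 0%N.
Qed.

Lemma meagre_sub A B : A `<=` B -> meagre B -> meagre A.
Proof.
move=> AB [F ndF BE]; exists (fun n => F n `&` A) => [n|].
  exact: nowhere_dense_sub (@subIsetl _ _ _) (ndF n).
by rewrite -setI_bigcupl -BE setIC; apply/esym/setIidPl.
Qed.

Lemma meagre0 : meagre set0.
Proof. exact/nowhere_dense_meagre/nowhere_dense0. Qed.

Lemma meagre_bigcup (F : (set K)^nat) :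
  (forall n, meagre (F n)) -> meagre (\bigcup_n F n).
Proof.
move=> /(_ _)/cid2-/all_sig2 [G ndG FG].
pose H n := if @unpickle (nat * nat)%type n is Some ij then G ij.1 ij.2 else set0.
exists H => [n|].
  by rewrite /H; case: unpickle => [ij|//]; [exact: ndG|exact: nowhere_dense0].
apply/seteqP; split=> x [n _].
  by rewrite FG => -[m _ Gx]; exists (pickle (n, m)) => //; rewrite /H pickleK.
rewrite /H; case: unpickle => [[i j] /= Gx|//].
by exists i => //; rewrite FG; exists j.
Qed.

Lemma meagreU A B : meagre A -> meagre B -> meagre (A `|` B).
Proof.
by move=> mA mB; rewrite -bigcup2E; apply: meagre_bigcup => -[//|[//|n]];
  exact: meagre0.
Qed.

Lemma baire_propertyP A :
  baire_property A <-> exists2 U, open U & meagre (A `+` U).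
Proof.
split=> [[U [N [oU mN ->]]]|[U oU mA]].
  by exists U => //; rewrite (setYC U) -setYA setYK setY0.
by exists U, (A `+` U); split=> //; rewrite setYC -setYA setYK setY0.
Qed.

Lemma open_baire_property U : open U -> baire_property U.
Proof.
by move=> oU; apply/baire_propertyP; exists U => //; rewrite setYK; exact: meagre0.
Qed.

Lemma meagre_baire_property A : meagre A -> baire_property A.
Proof.
by move=> mA; apply/baire_propertyP; exists set0; rewrite ?setY0//; exact: open0.
Qed.

Lemma baire_property0 : baire_property set0.
Proof. exact/open_baire_property/open0. Qed.

Lemma baire_propertyC A : baire_property A -> baire_property (~` A).
Proof.
move=> /baire_propertyP[U oU mAU]; apply/baire_propertyP.
exists (~` U)°; first exact: open_interior.
have clU : closed (~` U) by exact: open_closedC.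
have mB : meagre (~` U `\` (~` U)°).
  apply: nowhere_dense_meagre; rewrite /nowhere_dense.
  have cl : closed (~` U `\` (~` U)°).
    by apply: closedI => //; apply: open_closedC; exact: open_interior.
  rewrite -(closure_id _).1//; apply/seteqP; split=> // x xi.
  have [_ []] := interior_subset xi.
  by move: x xi; apply: interiorS => y [].
apply: meagre_sub (meagreU mAU mB) => x; rewrite !setY_def /=.
have := @interior_subset _ (~` U) x.
have [] := pselect (A x); have [] := pselect (U x);
  have [] := pselect ((~` U)° x); rewrite /=; tauto.
Qed.

Lemma baire_property_bigcup (F : (set K)^nat) :
  (forall n, baire_property (F n)) -> baire_property (\bigcup_n F n).
Proof.
move=> bF; have /all_sig2[U oU mU] n : {U | open U & meagre (F n `+` U)}.
  by apply: cid2; exact/baire_propertyP.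
apply/baire_propertyP; exists (\bigcup_n U n); first exact: bigcup_open.
apply: meagre_sub (meagre_bigcup mU) => x; rewrite setY_def.
by move=> [|] [[n _ xn]] nx; exists n => //; rewrite setY_def; [left|right];
  split=> // ?; apply: nx; exists n.
Qed.

Lemma sigma_algebra_baire_property : sigma_algebra [set: K] baire_property.
Proof.
split; [exact: baire_property0| |exact: baire_property_bigcup].
by move=> A bA; rewrite setTD; exact: baire_propertyC.
Qed.

End Category.

(* MathComp-Analysis only equips pointed types with a sigma-algebra; [x0] is
   used in proofs alone, and the space may be empty in what follows. *)
Definition baire_space (K : topologicalType) (x0 : K) : Type := K.

Section BaireSpace.
Variables (K : topologicalType) (x0 : K).
Local Notation T := (baire_space x0).
HB.instance Definition _ := Choice.on T.
HB.instance Definition _ := isPointed.Build T x0.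
HB.instance Definition _ := @isMeasurable.Build default_measure_display T
  (@baire_property K) (@baire_property0 K) (@baire_propertyC K)
  (@baire_property_bigcup K).
End BaireSpace.

Section BoundedBaireFunctions.
Variables (R : realType) (K : topologicalType).
Implicit Types f g : K -> R.

Definition baire_measurable f :=
  forall B : set (measurableTypeR R), measurable B -> baire_property (f @^-1` B).

Definition bounded_baire : {pred (K -> R)} :=
  mem [set f | baire_measurable f /\ exists M, forall x, `|f x| <= M].

Lemma baire_measurableP (x0 : K) f : baire_measurable f <->
  measurable_fun [set: baire_space x0] (f : baire_space x0 -> measurableTypeR R).
Proof.
split=> [mf _ B mB|mf B mB]; first by rewrite setTI; exact: mf.
by have := mf measurableT B mB; rewrite setTI.
Qed.

Lemma bounded_baire_submod_closed : submod_closed bounded_baire.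
Proof.
split.
  rewrite inE /=; split; last by exists 0 => x; rewrite normr0.
  move=> B mB; rewrite preimage_cst; case: ifP => _; last exact: baire_property0.
  exact/open_baire_property/openT.
move=> a f g; rewrite !inE /= => -[mf [M fM]] [mg [N gN]]; split; last first.
  exists (`|a| * M + N) => x.
  by rewrite (le_trans (ler_normD _ _))// lerD// normrM ler_wpM2l.
have [[x0 _]|/set0P/negP/negPn/eqP K0] := pselect ([set: K] !=set0); last first.
  move=> B _; rewrite (_ : _ @^-1` _ = set0); first exact: baire_property0.
  by apply/seteqP; split=> // x; rewrite -K0.
apply/(baire_measurableP x0); apply: measurable_funD; last exact/baire_measurableP.
by apply: measurable_funM => //; exact/baire_measurableP.
Qed.

HB.instance Definition _ := GRing.isSubmodClosed.Build _ _ bounded_baire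
  bounded_baire_submod_closed.

Record bbfun := BBFun { bbfun_val :> K -> R; _ : bbfun_val \in bounded_baire }.

HB.instance Definition _ := [isSub for bbfun_val].
HB.instance Definition _ := [Choice of bbfun by <:].
HB.instance Definition _ := [SubChoice_isSubLmodule of bbfun by <:].

Definition meagre_null : {pred bbfun} :=
  mem [set f : bbfun | meagre [set x | f x != 0]].

Lemma meagre_null_zmod_closed : zmod_closed meagre_null.
Proof.
split; first by rewrite inE /=; apply: meagre_sub (@meagre0 K) => x /=; rewrite eqxx.
move=> f g; rewrite !inE /= => mf mg; apply: meagre_sub (meagreU mf mg) => x /=.
rewrite [_ x](_ : _ = f x - g x)//; have [->|] := eqVneq (f x) 0; last by left.
by rewrite sub0r oppr_eq0; right.
Qed.

HB.instance Definition _ := GRing.isZmodClosed.Build _ meagre_null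
  meagre_null_zmod_closed.

End BoundedBaireFunctions.

Section Linfty.
Variables (R : realType) (K : topologicalType).
Local Notation B := (bbfun R K).

(* The Dedekind completion of C(K), under its identification (through
   u |-> hat u) with the bounded functions measurable for the sets with the
   property of Baire, modulo those vanishing off a meagre set. *)
Definition CKdelta : Type := Quotient.quot (@meagre_null R K).

HB.instance Definition _ := GRing.Zmodule.on CKdelta.
HB.instance Definition _ := @EqQuotient.on CKdelta.

Definition hat (u : B) : CKdelta := \pi_CKdelta u.

Implicit Types (f g h : B) (p q r : CKdelta) (a b c : R).

Lemma hat_repr p : hat (repr p) = p. Proof. exact: reprK. Qed.

Lemma hatP f g : hat f = hat g <-> meagre [set x | f x != g x].
Proof.
have E : [set x | f x != g x] = [set x | (f - g) x != 0].
  by apply: eq_set => x; rewrite -subr_eq0.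
rewrite E; split=> [/eqP|mfg].
  by rewrite -Quotient.idealrBE inE.
by apply/eqP; rewrite -Quotient.idealrBE inE.
Qed.

Lemma hatD f g : hat f + hat g = hat (f + g).
Proof. by rewrite /hat Quotient.pi_add. Qed.

Lemma hatB f g : hat f - hat g = hat (f - g).
Proof. by rewrite /hat raddfB. Qed.

Let scale a p : CKdelta := hat (a *: repr p).

Lemma meagre_eq_repr f : meagre [set x | repr (hat f) x != f x].
Proof. by apply/hatP; rewrite hat_repr. Qed.

Let scale_hat a f : scale a (hat f) = hat (a *: f).
Proof.
apply/hatP; apply: meagre_sub (meagre_eq_repr f) => x /=.
apply: contraNneq => E; apply/eqP.
by have := congr1 ( *%R a) E; exact.
Qed.

Let scaleA a b p : scale a (scale b p) = scale (a * b) p.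
Proof. by rewrite -(hat_repr p) !scale_hat scalerA. Qed.

Let scale1 : left_id 1 scale.
Proof. by move=> p; rewrite -(hat_repr p) scale_hat scale1r. Qed.

Let scaleDr : right_distributive scale +%R.
Proof.
by move=> a p q; rewrite -(hat_repr p) -(hat_repr q) hatD !scale_hat hatD scalerDr.
Qed.

Let scaleDl p : {morph scale^~ p : a b / a + b}.
Proof. by move=> a b; rewrite -(hat_repr p) !scale_hat hatD scalerDl. Qed.

HB.instance Definition _ := GRing.Zmodule_isLmodule.Build R CKdelta
  scaleA scale1 scaleDr scaleDl.

Lemma hatZ a f : a *: hat f = hat (a *: f).
Proof. exact: scale_hat. Qed.

Let lec p q := `[< meagre [set x | repr q x < repr p x] >].

Let lec_hat f g : lec (hat f) (hat g) <-> meagre [set x | g x < f x].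
Proof.
have mfg := meagreU (meagre_eq_repr f) (meagre_eq_repr g).
rewrite /lec; split=> [/asboolP mle|mle]; [|apply/asboolP];
  apply: meagre_sub (meagreU mle mfg) => x /= ltx;
  have [Ef|] := eqVneq (repr (hat f) x) (f x); try by right; left.
- have [Eg|] := eqVneq (repr (hat g) x) (g x); last by right; right.
  by left; rewrite Ef Eg.
- have [Eg|] := eqVneq (repr (hat g) x) (g x); last by right; right.
  by left; rewrite -Ef -Eg.
Qed.

Let lec_refl : reflexive lec.
Proof.
by move=> p; apply/asboolP; apply: meagre_sub (@meagre0 K) => x /=; rewrite ltxx.
Qed.

Let lec_anti : antisymmetric lec.
Proof.
move=> p q /andP[/asboolP pq /asboolP qp]; rewrite -(hat_repr p) -(hat_repr q).
by apply/hatP; apply: meagre_sub (meagreU pq qp) => x /=;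
  rewrite neq_lt => /orP[]; [right|left].
Qed.

Let lec_trans : transitive lec.
Proof.
move=> q p r /asboolP pq /asboolP qr; apply/asboolP.
apply: meagre_sub (meagreU pq qr) => x /= rp.
by have [|qp] := ltP (repr q x) (repr p x); [left|right; exact: lt_le_trans rp qp].
Qed.

HB.instance Definition _ := Order.Le_isPOrder.Build ring_display CKdelta
  lec_refl lec_anti lec_trans.

Lemma ler_hat f g : hat f <= hat g <-> meagre [set x | g x < f x].
Proof. exact: lec_hat. Qed.

Definition ess_bounds f := [set c | 0 <= c /\ meagre [set x | c < `|f x|]].

Let nrm p := inf (ess_bounds (repr p)).

Let nrm_hat f : nrm (hat f) = inf (ess_bounds f).
Proof.
congr inf; apply/seteqP; split=> c /= [c0 mc]; split=> //;
  apply: meagre_sub (meagreU mc (meagre_eq_repr f)) => x /= cx;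
  have [E|] := eqVneq (repr (hat f) x) (f x); try by right.
- by left; rewrite E.
- by left; rewrite -E.
Qed.

Lemma has_inf_ess_bounds f : has_inf (ess_bounds f).
Proof.
split; last by exists 0 => c [].
have : (f : K -> R) \in @bounded_baire R K by exact: valP.
rewrite inE /= => -[_ [M fM]]; exists `|M|; split=> //.
apply: meagre_sub (@meagre0 K) => x /=.
by rewrite ltNge (le_trans (fM x) (ler_norm M)).
Qed.

Lemma inf_ess_bounds f : ess_bounds f (inf (ess_bounds f)).
Proof.
split; first by apply: lb_le_inf; [case: (has_inf_ess_bounds f)|move=> c []].
have mn n : meagre [set x | inf (ess_bounds f) + n.+1%:R^-1 < `|f x|].
  have n0 : 0 < n.+1%:R^-1 :> R by rewrite invr_gt0.
  have [c [c0 mc] cn] := inf_adherent n0 (has_inf_ess_bounds f).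
  by apply: meagre_sub mc => x /=; exact: lt_trans.
apply: meagre_sub (meagre_bigcup mn) => x /= fx.
have [n fn] := ltr_add_invr fx.
by exists n.
Qed.

Let nrm_le f c : ess_bounds f c -> nrm (hat f) <= c.
Proof. by move=> fc; rewrite nrm_hat; apply: ge_inf => //; exists 0 => ? []. Qed.

Let ler_nrmD p q : nrm (p + q) <= nrm p + nrm q.
Proof.
rewrite -(hat_repr p) -(hat_repr q) hatD !nrm_hat.
move: (repr p) (repr q) => f g.
have [[f0 mf] [g0 mg]] := (inf_ess_bounds f, inf_ess_bounds g).
rewrite -nrm_hat; apply: nrm_le; split; first exact: addr_ge0.
apply: meagre_sub (meagreU mf mg) => x /= fgx.
have [|fx] := ltP (inf (ess_bounds f)) `|f x|; [by left|right].
rewrite ltNge; apply/negP => gx; move: fgx; apply/negP; rewrite -leNgt.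
exact: le_trans (ler_normD _ _) (lerD fx gx).
Qed.

Let nrmZ_le a p : nrm (a *: p) <= `|a| * nrm p.
Proof.
rewrite -(hat_repr p) hatZ nrm_hat -nrm_hat; move: (repr p) => f.
have [f0 mf] := inf_ess_bounds f; rewrite -nrm_hat in f0 mf.
apply: nrm_le; split; first by rewrite mulr_ge0.
apply: meagre_sub mf => x /=; rewrite ltNge => fx; rewrite ltNge.
apply: contraNN fx => fx; rewrite [`|_|](_ : _ = `|a| * `|f x|) ?ler_wpM2l//.
exact: normrM.
Qed.

Let nrm_ge0 p : 0 <= nrm p.
Proof. by rewrite -(hat_repr p) nrm_hat; case: (inf_ess_bounds (repr p)). Qed.

Let nrmZ a p : nrm (a *: p) = `|a| * nrm p.
Proof.
apply/eqP; rewrite eq_le nrmZ_le /=.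
have [->|a0] := eqVneq a 0; first by rewrite normr0 mul0r nrm_ge0.
rewrite -ler_pdivlMl ?normr_gt0// -normfV.
by rewrite -[X in nrm X <= _]scale1r -(mulVf a0) -scalerA nrmZ_le.
Qed.

Let nrm0_eq0 p : nrm p = 0 -> p = 0.
Proof.
rewrite -(hat_repr p) nrm_hat => f0.
have [_] := inf_ess_bounds (repr p); rewrite f0 => mf.
rewrite -(raddf0 (\pi_CKdelta : {additive B -> CKdelta})).
apply/hatP; apply: meagre_sub mf => x /=; rewrite normr_gt0.
exact.
Qed.

HB.instance Definition _ := Lmodule_isNormed.Build R CKdelta
  ler_nrmD nrmZ nrm0_eq0.

Lemma norm_hat f :
  `|hat f| = inf [set c | 0 <= c /\ meagre [set x | c < `|f x|]].
Proof. exact: nrm_hat. Qed.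

Lemma indic_bounded_baire (A : set K) :
  baire_property A -> (\1_A : K -> R) \in @bounded_baire R K.
Proof.
move=> bA; rewrite inE /=; split; last first.
  by exists 1 => x; rewrite indicE; case: (_ \in _); rewrite ?normr1 ?normr0.
have [[x0 _]|/set0P/negP/negPn/eqP K0] := pselect ([set: K] !=set0); last first.
  move=> D _; rewrite (_ : _ @^-1` _ = set0); first exact: baire_property0.
  by apply/seteqP; split=> // x; rewrite -K0.
by apply/(baire_measurableP x0)/measurable_indic.
Qed.

Definition hat_indic (A : set K) (bA : baire_property A) : CKdelta :=
  hat (BBFun (indic_bounded_baire bA)).

End Linfty.

Arguments CKdelta : clear implicits.

Section Dual.
Variables (R : realType) (K : topologicalType).

Definition positive_functional (phi : CKdelta R K -> R) :=
  forall p, 0 <= p -> 0 <= phi p.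

Definition strictly_positive (phi : CKdelta R K -> R) :=
  forall p, 0 < p -> 0 < phi p.

(* [phi] seen as a finitely additive measure: phi(A) = phi(hat 1_A). *)
Definition dual_measure (phi : CKdelta R K -> R) (A : set K)
  (bA : baire_property A) : R := phi (hat_indic R bA).

Lemma dual_measure_ge0 (phi : CKdelta R K -> R) (A : set K)
    (bA : baire_property A) :
  positive_functional phi -> 0 <= dual_measure phi bA.
Proof.
apply; rewrite -(raddf0 (\pi_(CKdelta R K) : {additive bbfun R K -> CKdelta R K})).
apply/ler_hat; apply: meagre_sub (@meagre0 K) => x /=.
by rewrite indicE ltNge ler0n.
Qed.

Lemma dual_measure_meagre (phi : {linear CKdelta R K -> R^o}) (A : set K)
    (bA : baire_property A) : meagre A -> dual_measure phi bA = 0.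
Proof.
move=> mA; rewrite /dual_measure (_ : hat_indic R bA = 0) ?linear0//.
rewrite -(raddf0 (\pi_(CKdelta R K) : {additive bbfun R K -> CKdelta R K})).
apply/hatP; apply: meagre_sub mA => x /=; rewrite indicE.
by case: (boolP (x \in A)) => [/set_mem//|_]; rewrite eqxx.
Qed.

Lemma dual_measureU (phi : {linear CKdelta R K -> R^o}) (A B : set K)
    (bA : baire_property A) (bB : baire_property B)
    (bAB : baire_property (A `|` B)) : A `&` B = set0 ->
  dual_measure phi bAB = dual_measure phi bA + dual_measure phi bB.
Proof.
move=> AB0; rewrite /dual_measure -linearD hatD; congr (phi _).
apply/hatP; apply: meagre_sub (@meagre0 K) => x /= /eqP; apply.
change (\1_(A `|` B) x = \1_A x + \1_B x :> R); rewrite !indicE in_setU.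
case: (boolP (x \in A)) => [/set_mem Ax|_]; last by rewrite add0r.
case: (boolP (x \in B)) => [/set_mem Bx|_]; last by rewrite addr0.
by have : set0 x by rewrite -AB0.
Qed.

End Dual.

(* Main.v *)
Require Import Defs.
From HB Require Import structures.
From mathcomp Require Import all_boot all_order all_algebra.
From mathcomp Require Import all_classical all_reals all_analysis.
Import Order.TTheory GRing.Theory Num.Theory.
Import numFieldNormedType.Exports.
Local Open Scope classical_set_scope.
Local Open Scope ring_scope.

(** The indicator of a non-meagre set [A] is a nonzero positive element, so a
    strictly positive functional charges [A].  Conversely, if [0 < hat f], then
    [{f > 0}] is the union of the sets [{f > 1/(n+1)}] and is not meagre, so one
    of these sets, say [A], is not meagre; since [f >= 1_A/(n+1)] off a meagre
    set, [phi (hat f) >= phi A / (n+1) > 0]. *)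

Lemma hat0 (R : realType) (K : topologicalType) : hat (0 : bbfun R K) = 0.
Proof. by rewrite -(subrr (hat 0)) hatB subrr. Qed.

Lemma hat_eq0 (R : realType) (K : topologicalType) (f : bbfun R K) :
  hat f = 0 <-> meagre [set x | f x != 0].
Proof. by rewrite -hat0 hatP. Qed.

Lemma hat_ge0 (R : realType) (K : topologicalType) (f : bbfun R K) :
  0 <= hat f <-> meagre [set x | f x < 0].
Proof. by rewrite -hat0 ler_hat. Qed.

Lemma hat_indic_ge0 (R : realType) (K : topologicalType) (A : set K)
  (bA : baire_property A) : 0 <= hat_indic R bA.
Proof.
apply/hat_ge0; apply: meagre_sub (@meagre0 K) => x /=.
by rewrite indicE ltNge ler0n.
Qed.

Lemma hat_indic_eq0 (R : realType) (K : topologicalType) (A : set K)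
  (bA : baire_property A) : hat_indic R bA = 0 <-> meagre A.
Proof.
rewrite /hat_indic hat_eq0 /= (_ : [set x | _] = A)//.
apply/seteqP; split=> x /=; rewrite indicE.
  by case: (boolP (x \in A)) => [/set_mem//|_]; rewrite eqxx.
by move=> /mem_set ->; rewrite oner_neq0.
Qed.

(** [hat_indic] takes a proof of the property of Baire; here it comes from measurability of [f], the
    set being the preimage of an open ray. *)
Lemma baire_property_gt (R : realType) (K : topologicalType) (f : bbfun R K)
  (c : R) : baire_property [set x | c < f x].
Proof.
have : (f : K -> R) \in @bounded_baire R K by exact: valP.
rewrite inE /= => -[/(_ `]c, +oo[%classic (measurable_itv _)) + _].
by congr baire_property; apply/seteqP; split=> x /=; rewrite in_itv /= andbT.
Qed.

Lemma hat_gt0_ge_indic (R : realType) (K : topologicalType) (p : CKdelta R K) :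
  0 < p -> exists (c : R) (A : set K) (bA : baire_property A),
    [/\ 0 < c, ~ meagre A & c *: hat_indic R bA <= p].
Proof.
rewrite -(hat_repr p); move: (repr p) => f.
rewrite lt_def => /andP[/eqP fN0 /hat_ge0 f_ge0].
have [n nA] : exists n, ~ meagre [set x | n.+1%:R^-1 < f x].
  (* Otherwise the set where [f] is nonzero is covered by the meagre set where [f < 0] and countably
     many meagre sets, so [hat f = 0]. *)
  apply/existsNP => mA; apply/fN0/hat_eq0.
  apply: meagre_sub (meagreU f_ge0 (meagre_bigcup mA)) => x /=.
  rewrite neq_lt => /orP[|fx]; first by left.
  right; have [n fn] : exists n, n.+1%:R^-1 < f x.
    by have [n] := ltr_add_invr fx; rewrite add0r; exists n.
  by exists n.
exists n.+1%:R^-1, _, (baire_property_gt _ _ f n.+1%:R^-1); split=> //.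
(* The inequality can fail only where [f < 0]: on the set itself [f] exceeds the constant, and off
   it the left side is 0. *)
rewrite hatZ; apply/ler_hat; apply: meagre_sub f_ge0 => x /=.
rewrite [X in _ < X](_ : _ = n.+1%:R^-1 * \1_[set x | n.+1%:R^-1 < f x] x)//.
rewrite indicE; case: (boolP (x \in _)) => [/set_mem /= fx|_].
  by rewrite mulr1 => /(lt_trans fx); rewrite ltxx.
by rewrite mulr0.
Qed.

Theorem proposition5p3 (R : realType) (K : topologicalType)
    (K_compact : compact [set: K]) (K_hausdorff : hausdorff_space K)
    (phi : {linear CKdelta R K -> R^o}) (phi_continuous : continuous phi)
    (phi_positive : positive_functional phi) :
  strictly_positive phi <->
  (forall (A : set K) (bA : baire_property A),
     dual_measure phi bA = 0 <-> meagre A).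
Proof.
split=> [phi_gt0 A bA|phi0 p /hat_gt0_ge_indic[c [A [bA [c_gt0 nA cAp]]]]].
  split=> [A0|]; last exact: dual_measure_meagre.
  (* A nonzero indicator class is strictly positive, so [phi] could not vanish on it. *)
  apply/(hat_indic_eq0 R _ _ bA)/eqP; apply/negPn/negP => An0.
  have := phi_gt0 (hat_indic R bA).
  rewrite lt_def An0 hat_indic_ge0 => /(_ isT).
  by rewrite -/(dual_measure phi bA) A0 ltxx.
have A_gt0 : 0 < dual_measure phi bA.
  by rewrite lt_def dual_measure_ge0// andbT; apply/eqP => /phi0.
have := phi_positive (p - c *: hat_indic R bA).
(* The difference is compared with 0 on representatives, where both the order and the subtraction
   are pointwise off a meagre set. *)
have -> : 0 <= p - c *: hat_indic R bA.
  move: cAp; rewrite -(hat_repr p) hatZ hatB => /ler_hat m; apply/hat_ge0.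
  apply: meagre_sub m => x /=; rewrite [X in X < 0](_ : _ =
    repr p x - c * \1_A x)//.
  by rewrite subr_lt0.
(* By linearity [phi p] is at least [c] times the measure of [A]. *)
move=> /(_ isT); rewrite linearB linearZ /= subr_ge0.
by apply: lt_le_trans; exact: mulr_gt0.
Qed.
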